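(* Let $n\ge1$ and let $P\in\mathcal{P}_0^n$ be a $0$-symmetric $n$-dimensional lattice polytope in $\mathbb{R}^n$. Let $-\gamma_1(P),\dots,-\gamma_n(P)\in\mathbb{C}$ be the roots of its Ehrhart polynomial (with multiplicity) and $\lambda_n(P)$ its $n$-th successive minimum. Then $$\frac1n\left(\sum_{i=1}^n\gamma_i(P)\right)\le\frac{\lambda_n(P)}{2}.$$
   Context: A lattice $n$-polytope is a convex polytope $P\subset\mathbb{R}^n$ with $\dim P=n$ all of whose vertices lie in $\mathbb{Z}^n$; $\mathcal{P}_0^n$ is the set of those that are $0$-symmetric ($P=-P$). The Ehrhart polynomial of $P$ is the unique polynomial $\mathrm{G}(s,P)=\sum_{i=0}^n \mathrm{G}_i(P)s^i$ with $\mathrm{G}(k,P)=\#(kP\cap\mathbb{Z}^n)$ for all positive integers $k$; it has degree $n$ and constant term $1$. It is regarded as a polynomial in $s\in\mathbb{C}$ and factored as $\mathrm{G}(s,P)=\prod_{i=1}^n\left(1+\frac{s}{\gamma_i(P)}\right)$, so its roots with multiplicity are $-\gamma_1(P),\dots,-\gamma_n(P)$. The sum $\sum_i\gamma_i(P)$ is real since the coefficients are real. For a $0$-symmetric convex body $K\subset\mathbb{R}^n$ with non-empty interior, the $i$-th successive minimum is $\lambda_i(K)=\min\{\lambda>0:\dim(\lambda K\cap\mathbb{Z}^n)\ge i\}$, where $\dim$ of a set of lattice points means the dimension of its linear span. *)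

(* Defs.v *)
From mathcomp Require Export all_boot all_order all_algebra.
From mathcomp Require Export finmap.
From mathcomp Require Export complex.
From mathcomp Require Export mathcomp_extra boolp classical_sets cardinality.
From mathcomp Require Export reals.

Set Implicit Arguments.
Unset Strict Implicit.
Unset Printing Implicit Defensive.

Export Order.TTheory GRing.Theory Num.Theory.

Open Scope classical_set_scope.
Open Scope ring_scope.
Open Scope complex_scope.

Definition Zlattice (R : realType) (n : nat) : set 'rV[R]_n :=
  [set x | forall j, x ord0 j \is a Num.int].

Definition dilate (R : realType) (n : nat) (l : R) (K : set 'rV[R]_n) :
  set 'rV[R]_n := [set l *: x | x in K].

Definition conv_hull (R : realType) (n m : nat) (v : 'I_m -> 'rV[R]_n) :
  set 'rV[R]_n :=
  [set x | exists a : 'I_m -> R, [/\ forall i, 0 <= a i, \sum_i a i = 1 &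
                                   x = \sum_i a i *: v i]].

Definition polytope (R : realType) (n : nat) (P : set 'rV[R]_n) : Prop :=
  exists m (v : 'I_m -> 'rV[R]_n), P = conv_hull v.

(* Vertices are rendered as extreme points. *)
Definition vertex (R : realType) (n : nat) (P : set 'rV[R]_n) (x : 'rV[R]_n) :
  Prop :=
  P x /\ forall y z (t : R), P y -> P z -> 0 < t -> t < 1 ->
    x = t *: y + (1 - t) *: z -> y = x /\ z = x.

Definition lattice_polytope (R : realType) (n : nat) (P : set 'rV[R]_n) : Prop :=
  polytope P /\ vertex P `<=` @Zlattice R n.

Definition is_lin_span (R : realType) (n : nat) (A : set 'rV[R]_n)
  (V : {vspace 'rV[R]_n}) : Prop :=
  A `<=` [set` V] /\
  forall W : {vspace 'rV[R]_n}, A `<=` [set` W] -> (V <= W)%VS.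

Lemma ex_lin_span (R : realType) (n : nat) (A : set 'rV[R]_n) :
  exists V, is_lin_span A V.
Proof.
pose Q d := `[< exists V : {vspace 'rV[R]_n}, A `<=` [set` V] /\ \dim V = d >].
have exQ : exists d, Q d.
  exists (\dim {:'rV[R]_n}); apply/asboolP; exists fullv; split => // x _ /=.
  exact: memvf.
case: (ex_minnP exQ) => d /asboolP[V [AV dV]] minV; exists V; split => // W AW.
have /eqP <- : (V :&: W)%VS == V.
  rewrite eqEdim capvSl /= dV; apply: minV; apply/asboolP.
  exists (V :&: W)%VS; split => // x Ax /=.
  by rewrite memv_cap; apply/andP; split; [exact: AV|exact: AW].
exact: capvSr.
Qed.

Definition lin_span (R : realType) (n : nat) (A : set 'rV[R]_n) :
  {vspace 'rV[R]_n} := xget 0%VS (is_lin_span A).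

Lemma lin_spanP (R : realType) (n : nat) (A : set 'rV[R]_n) :
  is_lin_span A (lin_span A).
Proof. by have [V AV] := ex_lin_span A; exact: (xgetI 0%VS AV). Qed.

(* Dimension of the affine hull, i.e. of its direction space.  By convention
   it is 0, not -1, for the empty set. *)
Definition aff_dim (R : realType) (n : nat) (A : set 'rV[R]_n) : nat :=
  \dim (lin_span [set x - y | x in A & y in A]).

(* [fset_set] is the empty set on infinite sets; for a polytope, which is
   bounded, the set counted below is finite. *)
Definition ehrhart_poly (R : realType) (n : nat) (P : set 'rV[R]_n)
  (G : {poly R}) : Prop :=
  forall k : nat, (0 < k)%N ->
    G.[k%:R] = (#|` fset_set (dilate k%:R P `&` @Zlattice R n) |)%:R.

(* The i-th successive minimum, with i counted from 1.  The infimum is a minimum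
   for bounded closed K with 0 in the interior, see [succ_minE]. *)
Definition succ_min_set (R : realType) (n : nat) (i : nat) (K : set 'rV[R]_n) :
  set R :=
  [set l | 0 < l /\ (i <= \dim (lin_span (dilate l K `&` @Zlattice R n)))%N].

Definition succ_min (R : realType) (n : nat) (i : nat) (K : set 'rV[R]_n) : R :=
  inf (succ_min_set i K).

Lemma succ_minE (R : realType) (n : nat) (i : nat) (K : set 'rV[R]_n) (l : R) :
  succ_min_set i K l -> lbound (succ_min_set i K) l -> succ_min i K = l.
Proof.
move=> Sl lbl; apply/eqP; rewrite eq_le; apply/andP; split.
  by apply: ge_inf => //; exists l.
by apply: lb_le_inf => //; exists l.
Qed.

Definition roots_with_mult (F : fieldType) (p : {poly F}) (s : seq F) : Prop :=
  p != 0 /\ p = lead_coef p *: \prod_(z <- s) ('X - z%:P).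

(* Main.v *)
Require Import Defs.
From mathcomp Require Import fsbigop ring lra zify.

(** Write [G(s) = G_n s^n + G_(n-1) s^(n-1) + ...]; the sum of the [gamma i] is
    [G_(n-1) / G_n], so the claim is [2 G_(n-1) <= n l G_n] with
    [l = lambda_n(P)].  Neither reciprocity nor the facet formula for [G_(n-1)]
    is used.  Put [N(t) = #(tP /\ Z^n)] and, for [m >= 1], sum over the residues
    [c] mod [m] the second differences
      [2 N(k) - #{z | z - c/m in kP} - #{z | z + c/m in (k + l)P}];
    the total is [2 m^n N(k) - N(mk) - N(m(k + l))].  If each second difference
    is at most [O(k^(n-2))], comparing coefficients of [k^(n-1)] gives
    [2 (m - 1) G_(n-1) <= n (m l + 1) G_n], and [m -> oo] concludes.

    To bound a second difference, only lattice points near exactly one facet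
    [h = k] of [kP] matter: points near two facets number [O(k^(n-2))].  By
    definition of [l] there is a lattice point [z] of [lP] with [0 < h z <= l], so
    some lattice translate [w = j z] brings [h (c/m + w)] into [[0, l]].  With
    [c/m + w] in place of [c/m] the summand is pointwise nonpositive near the
    facet, and the replacement changes the sum by a coboundary
    [Psi(x) - Psi(x - w)], which vanishes after summation over [Z^n]. *)

Set Implicit Arguments.
Unset Strict Implicit.
Unset Printing Implicit Defensive.

(** * Linear forms and halfspace representations *)

Definition dot (R : pzRingType) (n : nat) (u x : 'rV[R]_n) : R :=
  \sum_j u ord0 j * x ord0 j.

Section Dot.
Variables (R : comPzRingType) (n : nat).
Implicit Types (u x y : 'rV[R]_n).

Lemma dotC u x : dot u x = dot x u.
Proof. by apply: eq_bigr => j _; rewrite mulrC. Qed.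

Lemma dotDr u x y : dot u (x + y) = dot u x + dot u y.
Proof. by rewrite -big_split; apply: eq_bigr => j _; rewrite mxE mulrDr. Qed.

Lemma dotZr u a x : dot u (a *: x) = a * dot u x.
Proof. by rewrite big_distrr; apply: eq_bigr => j _; rewrite mxE mulrCA. Qed.

Lemma dotNr u x : dot u (- x) = - dot u x.
Proof. by rewrite -scaleN1r dotZr mulN1r. Qed.

Lemma dotBr u x y : dot u (x - y) = dot u x - dot u y.
Proof. by rewrite dotDr dotNr. Qed.

Lemma dotDl u v x : dot (u + v) x = dot u x + dot v x.
Proof. by rewrite dotC dotDr !(dotC x). Qed.

Lemma dotZl a u x : dot (a *: u) x = a * dot u x.
Proof. by rewrite dotC dotZr dotC. Qed.

Lemma dotNl u x : dot (- u) x = - dot u x.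
Proof. by rewrite dotC dotNr dotC. Qed.

Lemma dot0r u : dot u 0 = 0.
Proof. by rewrite -(scale0r 0) dotZr mul0r. Qed.

Lemma dot0l x : dot 0 x = 0.
Proof. by rewrite dotC dot0r. Qed.

Lemma dot_delta u j : dot u (delta_mx ord0 j) = u ord0 j.
Proof.
rewrite /dot (bigD1 j) //= mxE !eqxx mulr1 big1 ?addr0 // => i ij.
by rewrite mxE (negPf ij) andbF mulr0.
Qed.

Lemma dot_row_mx m u x (v y : 'rV[R]_m) :
  dot (row_mx u v) (row_mx x y) = dot u x + dot v y.
Proof.
rewrite /dot big_split_ord; congr (_ + _); apply: eq_bigr => j _.
  by rewrite !row_mxEl.
by rewrite !row_mxEr.
Qed.

End Dot.

(* One step of Fourier-Motzkin elimination. *)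
Lemma eliminate_ray (R : realFieldType) (N : nat) (us : seq 'rV[R]_N)
    (w : 'rV[R]_N) :
  exists us' : seq 'rV[R]_N, forall x,
    (exists t, 0 <= t /\ all (fun u => dot u (x - t *: w) <= 0) us) <->
    all (fun u => dot u x <= 0) us'.
Proof.
pose neg := [seq u <- us | dot u w < 0].
pose pos := [seq u <- us | 0 < dot u w].
(* The condition on [t] is [dot u x <= t * dot u w]: a lower bound on [t] for [u] in [pos], an upper
   bound for [u] in [neg]. Each pair is combined with nonnegative weights so that the result
   vanishes on [w]. *)
exists ([seq u <- us | dot u w <= 0] ++
        [seq dot p w *: q - dot q w *: p | p <- pos, q <- neg]) => x.
rewrite all_cat; split.
  move=> [t [t0 /allP tus]]; apply/andP; split.
    apply/allP => u; rewrite mem_filter => /andP[uw /tus].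
    by rewrite dotBr dotZr => h; nra.
  apply/allP => _ /allpairsP[[p q] /= [+ + ->]].
  rewrite !mem_filter => /andP[pw /tus hp] /andP[qw /tus hq].
  by move: hp hq; rewrite dotBr dotZr dotBr dotZr dotDl dotNl !dotZl; nra.
move=> /andP[/allP h0 /allP hpq].
(* The witness is the largest lower bound, or 0; it is built along the list while keeping the upper
   bounds from [neg]. *)
have low (s : seq 'rV[R]_N) : {subset s <= pos} ->
    exists t, [/\ 0 <= t, forall p, p \in s -> dot p x <= t * dot p w &
      forall q, q \in neg -> dot q x <= t * dot q w].
  elim: s => [|p s IH] sub.
    exists 0; split => // q; rewrite mem_filter => /andP[qw qus].
    by rewrite mul0r h0 // mem_filter ltW.
  have [t [t0 ts tn]] := IH (fun y ys => sub y (mem_behead (s := p :: s) ys)).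
  have := sub p (mem_head _ _); rewrite mem_filter => /andP[pw pus].
  have [le|lt] := leP (dot p x) (t * dot p w).
    by exists t; split => // y; rewrite inE => /predU1P[->|/ts].
  exists (dot p x / dot p w); have lt' : t < dot p x / dot p w by rewrite ltr_pdivlMr.
  split=> [|y|q qn]; first exact: ltW (le_lt_trans t0 lt').
    rewrite inE => /predU1P[->|ys]; first by rewrite divfK ?gt_eqF.
    apply: le_trans (ts _ ys) _; rewrite ler_wpM2r ?ltW //.
    by have := sub y; rewrite inE ys orbT mem_filter => /(_ isT)/andP[].
  have := hpq (dot p w *: q - dot q w *: p).
  rewrite dotDl dotNl !dotZl => /(_ _)/wrap[].
    by apply/allpairsP; exists (p, q); split => //=; rewrite mem_filter pw.
  by rewrite mulrAC ler_pdivlMr //; lra.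
have [t [t0 tp tn]] := low pos (fun _ h => h).
exists t; split => //; apply/allP => u uus; rewrite dotBr dotZr subr_le0.
have [uw|uw|uw] := ltrgtP (dot u w) 0.
- by apply: tn; rewrite mem_filter uw.
- by apply: tp; rewrite mem_filter uw.
- by rewrite uw mulr0 h0 // mem_filter uw lexx.
Qed.

(** Weyl's theorem for finitely generated cones, with one elimination per generator. The zero cone
    is cut out by the coordinate forms and their negatives. *)
Lemma cone_polyhedral (R : realFieldType) (N m : nat) (w : 'I_m -> 'rV[R]_N) :
  exists us : seq 'rV[R]_N, forall x,
    (exists a : 'I_m -> R, (forall i, 0 <= a i) /\ x = \sum_i a i *: w i) <->
    all (fun u => dot u x <= 0) us.
Proof.
elim: m w => [|m IH] w.
  exists ([seq delta_mx 0 j | j : 'I_N] ++ [seq - delta_mx 0 j | j : 'I_N]) => x.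
  split=> [[a [_ ->]]|].
    by rewrite big_ord0; apply/allP => u _; rewrite dot0r.
  rewrite all_cat => /andP[/allP h1 /allP h2]; exists (fun=> 0); split => //.
  rewrite big_ord0; apply/rowP => j; rewrite mxE; apply/le_anti/andP; split.
    by have := h1 _ (map_f _ (mem_enum 'I_N j)); rewrite dotC dot_delta.
  have := h2 _ (map_f _ (mem_enum 'I_N j)).
  by rewrite dotNl dotC dot_delta oppr_le0.
have [us husw] := IH (fun i => w (lift ord0 i)).
have [us' hus'] := eliminate_ray us (w ord0).
exists us' => x; rewrite -hus'; split=> [[a [a0 ->]]|[t [t0 /husw[a [a0 xE]]]]].
  exists (a ord0); split => //; apply/husw; exists (fun i => a (lift ord0 i)).
  by split => //; rewrite big_ord_recl addrAC subrr add0r.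
exists (fun i => if unlift ord0 i is Some j then a j else t); split.
  by move=> i; case: unliftP.
rewrite big_ord_recl unlift_none; under eq_bigr do rewrite liftK.
by rewrite -xE addrC subrK.
Qed.

(** The kernel of [dot u] is a subspace containing [A], so it contains the span, which is the whole
    space. *)
Lemma dot_eq0_lin_span (R : realType) (n : nat) (A : set 'rV[R]_n)
    (u : 'rV[R]_n) :
  (n <= \dim (lin_span A))%N -> (forall x, A x -> dot u x = 0) -> u = 0.
Proof.
move=> dimA uA; have [_ minA] := lin_spanP A.
have dotE x : x *m u^T = (dot u x)%:M.
  by apply/rowP => j; rewrite ord1 !mxE mulr1n; under eq_bigr do rewrite mxE mulrC.
pose f : 'Hom('rV[R]_n, 'rV[R]_1) := linfun (mulmxr u^T).
have Aker : A `<=` [set` lker f].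
  by move=> x Ax /=; rewrite memv_ker lfunE /= dotE uA // raddf0.
have /eqP kerT : lker f == fullv.
  rewrite eqEdim subvf dimvf /dim /= mul1n (leq_trans dimA) //.
  exact: dimvS (minA _ Aker).
apply/rowP => j; rewrite mxE -dot_delta.
have := memvf (delta_mx ord0 j : 'rV[R]_n).
rewrite -kerT memv_ker lfunE /= dotE => /eqP/matrixP h.
by have := h ord0 ord0; rewrite !mxE eqxx mulr1n.
Qed.

(** [P] is the slice at height 1 of the cone over the points (v_i, 1). Symmetry makes the offset of
    every inequality nonnegative; positive offsets are normalised to 1, and a zero offset forces a
    form vanishing on [P], hence the zero form by full dimension. *)
Lemma symmetric_polytope_halfspaces (R : realType) (n : nat)
    (P : set 'rV[R]_n) :
  (0 < n)%N -> polytope P -> aff_dim P = n -> P = [set - x | x in P] ->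
  exists H : seq 'rV[R]_n, [/\ uniq H, 0 \notin H & forall t x, 0 < t ->
    dilate t P x <-> all (fun h => dot h x <= t) H].
Proof.
move=> n0 [m [v Pv]] dimP symP.
have PN x : P x -> P (- x) by move=> Px; rewrite symP; exists x.
have P0' u : (forall x, P x -> dot u x = 0) -> u = 0.
  move=> uP; apply: (@dot_eq0_lin_span _ _ [set x - y | x in P & y in P]).
    by rewrite -/(aff_dim P) dimP.
  by move=> _ [x Px [y Py <-]]; rewrite dotBr !uP ?subrr.
(* If [P] were empty, every form would vanish on it, including the all-ones form, which is nonzero
   for positive [n]. *)
have [x0 Px0] : P !=set0.
  apply/set0P/eqP => P0; have /rowP c0 : const_mx 1 = 0 :> 'rV[R]_n.
    by apply: P0' => x; rewrite P0.
  by have /eqP := c0 (Ordinal n0); rewrite !mxE oner_eq0.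
have [us usP] := cone_polyhedral (fun i => row_mx (v i) (1%:M : 'rV[R]_1)).
have {}usP x : P x <-> all (fun u => dot u (row_mx x 1%:M) <= 0) us.
  rewrite -usP Pv; split=> [[a [a0 a1 ->]]|[a [a0]]].
    exists a; split => //.
    transitivity (row_mx (\sum_i a i *: v i) (\sum_i a i *: (1%:M : 'rV[R]_1))).
      by rewrite -scaler_suml a1 scale1r.
    apply/rowP => j; rewrite summxE.
    case: (split_ordP j) => k ->; rewrite ?row_mxEl ?row_mxEr summxE.
      by apply: eq_bigr => i _; rewrite !mxE (unsplitK (inl k)).
    by apply: eq_bigr => i _; rewrite !mxE (unsplitK (inr k)) ?mxE.
  move=> /rowP xE; exists a; split => //.
    have := xE (rshift n ord0); rewrite row_mxEr [LHS]mxE eqxx summxE => /esym; apply: etrans.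
    by apply: eq_bigr => i _; rewrite mxE row_mxEr mxE eqxx mulr1.
  apply/rowP => j; have := xE (lshift 1 j); rewrite row_mxEl !summxE => ->.
  by apply: eq_bigr => i _; rewrite !mxE (unsplitK (inl j)).
have usE (u : 'rV[R]_(n + 1)) (x : 'rV[R]_n) :
    dot u (row_mx x 1%:M) = dot (lsubmx u) x + rsubmx u 0 0.
  rewrite -{1}[u]hsubmxK. rewrite dot_row_mx; congr (_ + _).
  by rewrite /dot big_ord1 [1%:M _ _]mxE mulr1.
have P_us u x : u \in us -> P x -> dot (lsubmx u) x <= - rsubmx u 0 0.
  by move=> uus /usP/allP/(_ u uus); rewrite usE; lra.
have P_us' u x : u \in us -> P x -> - dot (lsubmx u) x <= - rsubmx u 0 0.
  by move=> uus /PN/(P_us u _ uus); rewrite dotNr.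
(* When the offset is zero, [lsubmx u] is zero too, so [hh u] is zero and gets filtered out. *)
pose hh (u : 'rV[R]_(n + 1)) := (- rsubmx u 0 0)^-1 *: lsubmx u.
have hhP u x t : 0 < t -> u \in us ->
    (dot u (row_mx (t^-1 *: x) 1%:M) <= 0) = (dot (hh u) x <= t).
  move=> t0 uus; rewrite usE dotZr dotZl.
  have b0 : 0 <= - rsubmx u 0 0.
    by have := P_us _ _ uus Px0; have := P_us' _ _ uus Px0; lra.
  have [b00|bn0] := eqVneq (- rsubmx u 0 0) 0.
    have -> : lsubmx u = 0.
      apply: P0' => x' Px'; apply/le_anti.
      have := P_us _ _ uus Px'; have := P_us' _ _ uus Px'.
      by rewrite b00 oppr_le0 => -> ->.
    have -> : rsubmx u 0 0 = 0 by lra.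
    by rewrite dot0l oppr0 !mulr0 addr0 lexx (ltW t0).
  have b1 : 0 < - rsubmx u 0 0 by rewrite lt_def bn0.
  rewrite -subr_ge0 opprD add0r addrC subr_ge0.
  by rewrite ler_pdivrMl // [RHS]ler_pdivrMl // mulrC.
exists (undup [seq h <- [seq hh u | u <- us] | h != 0]).
rewrite undup_uniq mem_undup mem_filter eqxx; split => // t x t0.
have -> : dilate t P x <-> P (t^-1 *: x).
  split=> [[y Py <-]|Px]; first by rewrite scalerA mulVf ?gt_eqF // scale1r.
  by exists (t^-1 *: x) => //; rewrite scalerA mulfV ?gt_eqF // scale1r.
rewrite usP; split=> /allP hus; apply/allP.
  move=> h; rewrite mem_undup mem_filter => /andP[_ /mapP[u uus ->]].
  by rewrite -hhP // hus.
move=> u uus; rewrite hhP //; have [->|hn0] := eqVneq (hh u) 0.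
  by rewrite dot0l ltW.
by apply: hus; rewrite mem_undup mem_filter hn0 map_f.
Qed.

Lemma polytope_bounded (R : realType) (n : nat) (P : set 'rV[R]_n) :
  polytope P -> exists2 B : R, 0 <= B &
    forall t x, 0 <= t -> dilate t P x -> forall j, `|x ord0 j| <= B * t.
Proof.
move=> [m [v ->]]; exists (\sum_i \sum_j `|v i ord0 j|).
  by apply: sumr_ge0 => i _; apply: sumr_ge0.
move=> t _ t0 [_ [a [a0 a1 ->]] <-] j.
rewrite mxE normrM ger0_norm // mulrC ler_wpM2r // summxE.
apply: le_trans (ler_norm_sum _ _ _) _; apply: ler_sum => i _.
have ai1 : a i <= 1 by rewrite -a1 (bigD1 i) //= lerDl sumr_ge0.
rewrite mxE normrM ger0_norm //; apply: le_trans (ler_piMl _ ai1) _ => //.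
by rewrite (bigD1 j) //= lerDl sumr_ge0.
Qed.

(** * Finitely supported sums *)

(** A sum over [[set: T]] takes the default value 0 when the support is infinite, so additivity and
    monotonicity are stated under this condition. *)
Definition fin_supp (T : choiceType) (V : nmodType) (F : T -> V) : Prop :=
  finite_set [set x | F x != 0].

Section FiniteSupport.
Variables (T : choiceType) (R : numDomainType).
Implicit Types (F G : T -> R).

Lemma fsum_bigfset F (A : {fset T}) : (forall x, x \notin A -> F x = 0) ->
  \sum_(x \in [set: T]) F x = \sum_(x <- A) F x.
Proof. exact: fsbigTE. Qed.

Lemma fin_suppP F : fin_supp F <->
  exists A : {fset T}, forall x, x \notin A -> F x = 0.
Proof.
split=> [fF|[A FA]].
  exists (fset_set [set x | F x != 0]) => x; rewrite in_fset_set // notin_setE.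
  by move/negP; rewrite negbK => /eqP.
apply: (@sub_finite_set _ _ [set` A]) => [x /= /eqP Fx|]; last exact: finite_fset.
by apply: contra_notT Fx => /FA.
Qed.

Lemma fin_suppD F G : fin_supp F -> fin_supp G -> fin_supp (fun x => F x + G x).
Proof.
move=> fF fG; apply: sub_finite_set
  (_ : finite_set ([set x | F x != 0] `|` [set x | G x != 0])).
  move=> x /=; have [->|] := eqVneq (F x) 0; first by rewrite add0r; right.
  by left.
by rewrite finite_setU.
Qed.

Lemma fin_suppZ a F : fin_supp F -> fin_supp (fun x => a * F x).
Proof.
apply: sub_finite_set => x /=; apply: contra_neq => ->.
by rewrite mulr0.
Qed.

Lemma fin_suppN F : fin_supp F -> fin_supp (fun x => - F x).
Proof.
apply: sub_finite_set => x /=; apply: contra_neq => ->.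
by rewrite oppr0.
Qed.

Lemma fin_suppB F G : fin_supp F -> fin_supp G -> fin_supp (fun x => F x - G x).
Proof. by move=> fF /fin_suppN; exact: fin_suppD. Qed.

Lemma fin_supp_inj (U : choiceType) (F : U -> R) (f : T -> U) :
  injective f -> fin_supp F -> fin_supp (fun x => F (f x)).
Proof. by move=> fI; apply: finite_preimage => x y _ _ /fI. Qed.

Lemma fsumD F G : fin_supp F -> fin_supp G ->
  \sum_(x \in [set: T]) (F x + G x) =
  \sum_(x \in [set: T]) F x + \sum_(x \in [set: T]) G x.
Proof.
move=> /fin_suppP[A FA] /fin_suppP[B GB].
rewrite !(@fsum_bigfset _ (A `|` B)%fset) ?big_split //.
all: by move=> x; rewrite inE negb_or => /andP[xA xB]; rewrite ?FA ?GB ?addr0.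
Qed.

Lemma fsumB F G : fin_supp F -> fin_supp G ->
  \sum_(x \in [set: T]) (F x - G x) =
  \sum_(x \in [set: T]) F x - \sum_(x \in [set: T]) G x.
Proof.
move=> fF fG; apply/eqP; rewrite -subr_eq opprK eq_sym; apply/eqP.
rewrite -fsumD //; last exact: fin_suppB.
by under [RHS]eq_fsbigr do rewrite subrK.
Qed.

Lemma fin_supp_sum I (s : seq I) (F : I -> T -> R) :
  (forall i, fin_supp (F i)) -> fin_supp (fun x => \sum_(i <- s) F i x).
Proof.
move=> fF; elim: s => [|i s IH].
  by apply/fin_suppP; exists fset0 => x _; rewrite big_nil.
rewrite /fin_supp; under eq_set do rewrite big_cons.
exact: fin_suppD.
Qed.

Lemma exchange_fsum I (s : seq I) (F : I -> T -> R) :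
  (forall i, fin_supp (F i)) ->
  \sum_(x \in [set: T]) \sum_(i <- s) F i x =
  \sum_(i <- s) \sum_(x \in [set: T]) F i x.
Proof.
move=> fF; elim: s => [|i s IH].
  by rewrite big_nil fsbig1 // => x _; rewrite big_nil.
under eq_fsbigr do rewrite big_cons.
by rewrite fsumD ?IH ?big_cons //; exact: fin_supp_sum.
Qed.

Lemma ler_fsum F G : fin_supp F -> fin_supp G -> (forall x, F x <= G x) ->
  \sum_(x \in [set: T]) F x <= \sum_(x \in [set: T]) G x.
Proof.
move=> /fin_suppP[A FA] /fin_suppP[B GB] FG.
rewrite !(@fsum_bigfset _ (A `|` B)%fset) ?ler_sum //.
all: by move=> x; rewrite inE negb_or => /andP[xA xB]; rewrite ?FA ?GB.
Qed.

Lemma fin_supp_indic (p : pred T) :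
  finite_set [set x | p x] -> fin_supp (fun x => ((p x)%:R : R)).
Proof.
by apply: sub_finite_set => x /=; case: (p x) => //; rewrite eqxx.
Qed.

Lemma fsum_indic (p : pred T) : finite_set [set x | p x] ->
  \sum_(x \in [set: T]) ((p x)%:R : R) = #|` fset_set [set x | p x]|%:R.
Proof.
move=> fp; rewrite (@fsum_bigfset _ (fset_set [set x | p x])) => [|x].
  rewrite card_fset_sum1 natr_sum; apply: eq_big_seq => x.
  by rewrite in_fset_set // inE /= => ->.
by rewrite in_fset_set // notin_setE /= => /negP/negPf ->.
Qed.

End FiniteSupport.

(** The codes [c x] inject [A] into a box. Finiteness belongs to the conclusion because [fset_set]
    sends infinite sets to the empty one. *)
Lemma fset_set_card_le_prod (T : choiceType) (n : nat) (A : set T)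
    (b : 'I_n -> nat) (c : T -> 'I_n -> nat) :
  (forall x, A x -> forall j, (c x j < b j)%N) ->
  (forall x y, A x -> A y -> c x =1 c y -> x = y) ->
  finite_set A /\ (#|` fset_set A| <= \prod_j b j)%N.
Proof.
move=> cb cI; pose B := (\sum_j b j)%N.
pose f x : {ffun 'I_n -> 'I_B.+1} := [ffun j => inord (c x j)].
have ltB x j : A x -> (c x j < B.+1)%N.
  move=> Ax; rewrite ltnS (leq_trans (ltnW (cb x Ax j))) //.
  by rewrite /B (bigD1 j) //= leq_addr.
have fI : {in A &, injective f}.
  move=> x y; rewrite !inE => Ax Ay /ffunP fxy; apply: cI => // j.
  by have /(congr1 val) := fxy j; rewrite !ffunE /= !inordK ?ltB.
have fA : finite_set A.
  by rewrite -(eq_finite_set (inj_card_eq fI)); exact: finite_finset.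
split => //.
have -> : (#|` fset_set A| = size [seq f x | x <- fset_set A])%N by rewrite size_map.
pose F j : pred 'I_B.+1 := fun i => (i < b j)%N.
suff cF : (#|family F| <= \prod_j b j)%N.
  apply: leq_trans cF; rewrite cardE; apply: uniq_leq_size.
    rewrite map_inj_in_uniq ?fset_uniq // => x y; rewrite !in_fset_set //.
    exact: fI.
  move=> _ /mapP[x + ->]; rewrite in_fset_set // inE => Ax.
  by rewrite mem_enum; apply/familyP => j; rewrite ffunE unfold_in /F inordK ?ltB ?cb.
rewrite card_family foldrE big_map big_enum /=; apply: leq_prod => j _.
rewrite cardE -(size_map val) -[leqRHS](size_iota 0).
apply: uniq_leq_size; first by rewrite (map_inj_uniq val_inj) enum_uniq.
by move=> _ /mapP[i + ->]; rewrite mem_enum mem_iota.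
Qed.

(** * Lattice points near two facets *)

Definition realv (R : pzRingType) (n : nat) (x : 'rV[int]_n) : 'rV[R]_n :=
  map_mx intr x.

Lemma lt_floor_eq (R : archiRealDomainType) (x y : R) :
  Num.floor x = Num.floor y -> `|x - y| < 1.
Proof.
move=> xy; have := floor_itv x; have := floor_itv y.
by rewrite xy !intrD => /andP[? ?] /andP[? ?]; rewrite ltr_norml; lra.
Qed.

Lemma absz_ltS (z M : int) : 0 <= z -> z <= M -> (`|z| < `|M|.+1)%N.
Proof. lia. Qed.

Lemma absz_inj_nneg (y z : int) : 0 <= y -> 0 <= z -> `|y|%N = `|z|%N -> y = z.
Proof. lia. Qed.

Lemma absz_shift_lt (z : int) (N : nat) :
  `|z| <= N%:Z -> (`|(z + N%:Z)%R| < 2 * N + 1)%N.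
Proof. lia. Qed.

Lemma absz_shift_inj (y z : int) (N : nat) : `|y| <= N%:Z -> `|z| <= N%:Z ->
  `|(y + N%:Z)%R|%N = `|(z + N%:Z)%R|%N -> y = z.
Proof. lia. Qed.

(* The count is O(k^(n-2)); the extra factor [k] on the left makes the statement
   meaningful for [n = 1], where there is no such point for large [k]. *)
Lemma near_two_hyperplanes (R : realType) (n : nat) (h h' : 'rV[R]_n)
    (B : nat) (D : R) : h != h' -> h != 0 -> 0 <= D ->
  exists K k0 : nat, forall k : nat, (k0 <= k)%N ->
    let A := [set x : 'rV[int]_n | [/\ forall j, `|x ord0 j| <= (B * k)%:Z,
      `|dot h (realv R x) - k%:R| <= D & `|dot h' (realv R x) - k%:R| <= D]] in
    finite_set A /\ (k * #|` fset_set A| <= K * k ^ n.-1)%N.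
Proof.
move=> hh' h0 D0.
(* If all 2x2 minors vanish, then [h' = r *: h] with [r != 1], and nearness to both hyperplanes
   gives k |1 - r| <= D (1 + |r|): for large [k] there is no such point. *)
have [[p [q minor]]|prop] :=
  pselect (exists p q, h ord0 p * h' ord0 q - h ord0 q * h' ord0 p != 0); last first.
  have [p hp] : exists p, h ord0 p != 0.
    apply: contra_neqP h0 => /forallNP hp0; apply/rowP => p; rewrite mxE.
    by apply/eqP; rewrite -[_ == _]negbK; apply/negP/hp0.
  pose r := h' ord0 p / h ord0 p.
  have h'E : h' = r *: h.
    apply/rowP => q; rewrite mxE; move/forallNP/(_ p)/forallNP/(_ q)/negP: prop.
    rewrite negbK subr_eq0 => /eqP e; apply: (mulfI hp); rewrite e /r.
    by field.
  have r1 : 0 < `|1 - r|.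
    by rewrite normr_gt0 subr_eq0; apply: contra_neq hh'; rewrite h'E => <-; rewrite scale1r.
  exists 0%N, (Num.bound (D * (1 + `|r|) / `|1 - r|)) => k kbig /=.
  set A := mkset _; suff -> : A = set0.
    by split; [exact: finite_set0 | rewrite fset_set0 muln0].
  rewrite -subset0 => x [_ hx h'x].
  suff : k%:R <= D * (1 + `|r|) / `|1 - r|.
    rewrite leNgt => /negP; apply.
    apply: lt_le_trans (_ : (Num.bound (D * (1 + `|r|) / `|1 - r|))%:R <= _);
      last by rewrite ler_nat.
    by apply: archi_boundP; rewrite divr_ge0 // mulr_ge0 // addr_ge0.
  rewrite ler_pdivlMr // -[k%:R]ger0_norm // -normrM.
  have -> : k%:R * (1 - r) = r * (dot h (realv R x) - k%:R) - (dot h' (realv R x) - k%:R).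
    by rewrite h'E dotZl; ring.
  apply: le_trans (ler_normB _ _) _; rewrite [leRHS]mulrDr mulr1 addrC lerD //.
  by rewrite normrM mulrC ler_wpM2r.
have pq : p != q.
  by apply: contra_neq minor => ->; rewrite subrr.
(* Lattice points agreeing off [p], [q] and lying in the same cells of width
   [S^-1] for [h] and [h'] coincide, by Cramer's rule in the coordinates [p], [q]. *)
pose m0 := h ord0 p * h' ord0 q - h ord0 q * h' ord0 p.
have m00 : 0 < `|m0| by rewrite normr_gt0.
pose s0 : R := `|h ord0 p| + `|h ord0 q| + `|h' ord0 p| + `|h' ord0 q|.
have s00 : 0 <= s0 by rewrite !addr_ge0.
(* Chosen so that s0 / S < |m0|: by Cramer, two points in the same cells have |m0 d| < |m0| for the
   integer difference d of their [p] or [q] coordinates, so d = 0. *)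
pose S : R := (s0 + 1) / `|m0|.
have S0 : 0 < S by rewrite divr_gt0 // ltr_wpDl.
pose L := `|Num.floor (S * (D + D))|%N.+1.
(* At most [L] cells for each form, independently of [k], and at most 2Bk + 1 <= (2B + 1) k values
   for each of the other n - 2 coordinates. *)
exists (L * L * (2 * B + 1) ^ n.-2)%N, 1%N => k k0 /=.
set A := mkset _.
pose cd (u : 'rV[R]_n) x := Num.floor (S * (dot u (realv R x) - k%:R + D)).
pose c x j := if j == p then `|cd h x|%N else if j == q then `|cd h' x|%N
              else `|(x ord0 j + (B * k)%:Z)%R|%N.
pose b j := if (j == p) || (j == q) then L else (2 * B * k + 1)%N.
have cd0 u x : `|dot u (realv R x) - k%:R| <= D ->
    (0 <= cd u x) /\ (cd u x <= Num.floor (S * (D + D))).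
  rewrite ler_norml => /andP[lo hi]; split.
    by rewrite floor_ge0 mulr_ge0 ?(ltW S0) //; lra.
  by apply: le_floor; rewrite ler_pM2l //; lra.
have cb x : A x -> forall j, (c x j < b j)%N.
  move=> [xB hx h'x] j; rewrite /c /b.
  have [_|jp] /= := eqVneq j p; first by have [? ?] := cd0 _ _ hx; exact: absz_ltS.
  have [_|jq] /= := eqVneq j q; first by have [? ?] := cd0 _ _ h'x; exact: absz_ltS.
  by rewrite -mulnA absz_shift_lt.
have cI x y : A x -> A y -> c x =1 c y -> x = y.
  move=> [xB hx h'x] [yB hy h'y] cxy.
  have e j : j != p -> j != q -> x ord0 j = y ord0 j.
    move=> jp jq; have := cxy j; rewrite /c (negPf jp) (negPf jq).
    exact: absz_shift_inj (xB j) (yB j).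
  have close u : `|dot u (realv R x) - k%:R| <= D -> `|dot u (realv R y) - k%:R| <= D ->
      `|cd u x|%N = `|cd u y|%N -> `|dot u (realv R (x - y))| < S^-1.
    move=> /cd0[x0 _] /cd0[y0 _] cuxy; have {}cuxy := absz_inj_nneg x0 y0 cuxy.
    rewrite -(ltr_pM2l S0) mulfV ?gt_eqF // -[S in S * _]gtr0_norm // -normrM.
    rewrite /realv map_mxB dotBr.
    by have := lt_floor_eq cuxy; congr (`|_| < 1); ring.
  have hxy := close _ hx hy; have h'xy := close _ h'x h'y.
  have := cxy p; rewrite /c eqxx => /hxy{}hxy.
  have := cxy q; rewrite /c eqxx eq_sym (negPf pq) => /h'xy{}h'xy.
  have dE u : dot u (realv R (x - y)) = u ord0 p * (x ord0 p - y ord0 p)%:~R +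
      u ord0 q * (x ord0 q - y ord0 q)%:~R.
    rewrite /dot (bigD1 p) //= (bigD1 q) 1?eq_sym //= big1 ?addr0; first by rewrite !mxE.
    by move=> j /andP[jp jq]; rewrite !mxE e // subrr mulr0.
  have small (d : int) : `|m0 * d%:~R| < `|m0| -> d = 0.
    rewrite normrM -[ltRHS]mulr1 ltr_pM2l // -intr_norm (ltr_int _ _ 1).
    by clear -d; lia.
  have comb a a' : `|a| <= s0 -> `|a'| <= s0 -> `|a| + `|a'| <= s0 ->
      `|a * dot h (realv R (x - y)) + a' * dot h' (realv R (x - y))| < `|m0|.
    move=> as0 a's0 aa'; apply: le_lt_trans (ler_normD _ _) _; rewrite !normrM.
    apply: le_lt_trans (_ : (`|a| + `|a'|) * S^-1 < _).
      by rewrite mulrDl lerD // ler_wpM2l // ltW.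
    by rewrite /S invf_div mulrA ltr_pdivrMr ?ltr_wpDl // mulrC ltr_pM2l // ; lra.
  have := normr_ge0 (h ord0 p); have := normr_ge0 (h ord0 q).
  have := normr_ge0 (h' ord0 p); have := normr_ge0 (h' ord0 q) => ? ? ? ?.
  have dp : x ord0 p - y ord0 p = 0.
    apply: small; have := comb (h' ord0 q) (- h ord0 q).
    rewrite normrN => /(_ _ _ _)/wrap[| | |].
    - by rewrite /s0; lra.
    - by rewrite /s0; lra.
    - by rewrite /s0; lra.
    by rewrite !dE; congr (`|_| < _); rewrite /m0; ring.
  have dq : x ord0 q - y ord0 q = 0.
    apply: small; have := comb (- h' ord0 p) (h ord0 p).
    rewrite normrN => /(_ _ _ _)/wrap[| | |].
    - by rewrite /s0; lra.
    - by rewrite /s0; lra.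
    - by rewrite /s0; lra.
    by rewrite !dE; congr (`|_| < _); rewrite /m0; ring.
  apply/rowP => j; have [->|jp] := eqVneq j p; first exact: subr0_eq.
  by have [->|jq] := eqVneq j q; [exact: subr0_eq | exact: e].
have [fA cA] := fset_set_card_le_prod cb cI; split => //.
have {}cA : (#|` fset_set A| <= L * L * (2 * B * k + 1) ^ n.-2)%N.
  apply: leq_trans cA _; rewrite (bigD1 p) //= (bigD1 q) 1?eq_sym //=.
  rewrite /b !eqxx orbT /= mulnA leq_mul2l; apply/orP; right.
  rewrite (eq_bigr (fun=> (2 * B * k + 1)%N)).
    rewrite prod_nat_const (_ : #|_| = n.-2) //.
    rewrite (@eq_card _ _ (~: [set p; q])) => [|j]; last by rewrite !inE negb_or.
    have := cardsC [set p; q]; rewrite cards2 pq card_ord.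
    by move=> /(congr1 (subn^~ 2%N)); rewrite addKn subn2.
  by move=> j /andP[/negPf -> /negPf ->].
(* The distinct indices [p] and [q] force n >= 2, so the predecessors are not truncated. *)
have n2 : n.-1 = n.-2.+1.
  have := ltn_ord p; have := ltn_ord q; move: pq; rewrite -val_eqE /=.
  by clear; lia.
apply: leq_trans (leq_mul (leqnn k) cA) _.
rewrite (mulnCA k) -[leqRHS]mulnA leq_mul2l; apply/orP; right.
rewrite n2 expnS [leqRHS]mulnCA leq_mul2l; apply/orP; right.
by rewrite -expnMn; case: n.-2 => // d; rewrite leq_exp2r // -mulnA; move: k0; clear; nia.
Qed.

(** * Second differences of the lattice point count *)

Definition below (R : realType) (n : nat) (H : seq 'rV[R]_n) (t : R)
  (x : 'rV[R]_n) : bool := all (fun h => dot h x <= t) H.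

Section SecondDifference.
Variables (R : realType) (n : nat) (H : seq 'rV[R]_n) (l k C : R).
Variables (g : 'rV[R]_n) (w : 'rV[R]_n -> 'rV[R]_n).

(* With [e = h g] and [o = h (w h)], and [f_e s] the second difference
   [2 [s <= k] - [s <= k + e] - [s <= k + l - e]] along the facet [h], one has
   [f_e s - f_(e + o) s = facet_profile h s - facet_profile h (s - o)]. *)
Definition facet_profile h (s : R) : R :=
  (s <= k + l - dot h g - dot h (w h))%R%:R - (s <= k + dot h g)%R%:R.

(** The potential whose coboundary is subtracted. The cutoff gives it finite support; its margin
    exceeds 2C, so a point within 2C of the hyperplane [h = k] and its translate by [- w h] both
    satisfy the cutoff inequality for [h]. *)
Definition facet_term h x : R :=
  facet_profile h (dot h x) * (below H (k + 3 * C) x)%:R.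

Definition near_two h h' (x : 'rV[R]_n) : bool :=
  [&& h != h', below H (k + 6 * C) x, `|dot h x - k| <= 6 * C &
      `|dot h' x - k| <= 6 * C].

(** Both thresholds lie within [C] of [k], so farther away the two indicators agree. *)
Lemma facet_profile0 h s : l <= C -> `|dot h g| <= C ->
  0 <= dot h g + dot h (w h) <= l -> C < `|s - k| -> facet_profile h s = 0.
Proof.
move=> lC; rewrite ler_norml => /andP[g1 g2] /andP[gw1 gw2].
rewrite ltr_normr /facet_profile => sk.
suff -> : (s <= k + l - dot h g - dot h (w h)) = (s <= k + dot h g) by rewrite subrr.
by case/orP: sk => sk; apply/idP/idP => ?; lra.
Qed.

Lemma facet_profile_le1 h s : `|facet_profile h s| <= 1.
Proof.
rewrite /facet_profile; case: (s <= _); case: (s <= _).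
all: by rewrite ?subrr ?sub0r ?subr0 ?normrN ?normr1 ?normr0.
Qed.

Lemma facet_term_le1 h x : `|facet_term h x| <= 1.
Proof.
rewrite /facet_term; case: (below _ _ _); last by rewrite mulr0 normr0.
by rewrite mulr1 facet_profile_le1.
Qed.

Lemma below_single h x t : h \in H ->
  (forall h', h' \in H -> h' != h -> dot h' x <= t) ->
  below H t x = (dot h x <= t).
Proof.
move=> hH hx; apply/allP/idP => [/(_ _ hH)//|ht h' h'H].
by have [->//|/hx->] := eqVneq h' h.
Qed.

(** Case analysis on the position of [x]: near two facets, outside, deep inside, or near exactly one
    facet. The margin 6C keeps the position relative to the other facets unchanged under all shifts
    involved. *)
Lemma second_difference_le x : uniq H -> 0 <= C -> l <= C ->
  (forall h, h \in H -> `|dot h g| <= C) ->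
  (forall h h', h \in H -> h' \in H -> `|dot h (w h')| <= C) ->
  (forall h, h \in H -> 0 <= dot h g + dot h (w h) <= l) ->
  2 * (below H k x)%:R - (below H k (x - g))%:R - (below H (k + l) (x + g))%:R
  <= \sum_(h <- H) (facet_term h x - facet_term h (x - w h)) +
     (2 + 2 * (size H)%:R) * \sum_(h <- H) \sum_(h' <- H) (near_two h h' x)%:R
  :> R.
Proof.
move=> uH C0 lC gC wC gw.
have profile0 h s : h \in H -> C < `|s - k| -> facet_profile h s = 0.
  by move=> hH; apply: facet_profile0; rewrite ?gC ?gw.
(* Near two facets crude bounds suffice: the left side is at most 2, each coboundary at least -2,
   and the double sum at least 1. *)
have [/hasP[h hH /hasP[h' h'H near]]|nonear] :=
    boolP (has (fun h => has (fun h' => near_two h h' x) H) H).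
  have f2 : 2 * (below H k x)%:R - (below H k (x - g))%:R -
      (below H (k + l) (x + g))%:R <= 2 :> R.
    by do 3 case: (below _ _ _) => /=; lra.
  have s2 : - (2 * (size H)%:R) <= \sum_(h <- H) (facet_term h x - facet_term h (x - w h)).
    rewrite -mulNr mulr_natr -iter_addr_0 -count_predT -big_const_seq ler_sum // => i _.
    have := facet_term_le1 i x; have := facet_term_le1 i (x - w i).
    by rewrite !ler_norml => /andP[? ?] /andP[? ?]; lra.
  have near1 : 1 <= \sum_(h <- H) \sum_(h' <- H) (near_two h h' x)%:R :> R.
    rewrite (bigD1_seq h) //= (bigD1_seq h') //= near -addrA lerDl.
    by rewrite addr_ge0 // !sumr_ge0 // => *; rewrite ?sumr_ge0.
  have s0 : 0 <= (size H)%:R :> R by [].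
  by nra.
have -> : \sum_(h <- H) \sum_(h' <- H) (near_two h h' x)%:R = 0 :> R.
  rewrite big_seq big1 // => h hH; rewrite big_seq big1 // => h' h'H.
  by have := hasPn nonear h hH => /hasPn/(_ h' h'H)/negPf ->.
rewrite mulr0 addr0.
have sgn y h h' (hH : h \in H) (h'H : h' \in H) :
    dot h y - C <= dot h (y - w h') <= dot h y + C.
  by have := wC _ _ hH h'H; rewrite dotBr ler_norml => /andP[? ?]; apply/andP; split; lra.
have gsgn y h (hH : h \in H) : (dot h y - C <= dot h (y - g) <= dot h y + C)
    /\ (dot h y - C <= dot h (y + g) <= dot h y + C).
  have := gC _ hH; rewrite dotBr dotDr ler_norml => /andP[? ?].
  by split; apply/andP; split; lra.
have term0 h : h \in H -> dot h x < k - 6 * C ->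
    facet_term h x - facet_term h (x - w h) = 0.
  move=> hH hx; have /andP[_ ?] := sgn x h h hH hH.
  rewrite /facet_term !profile0 ?mul0r ?subrr //.
    by rewrite distrC ltr_normr; apply/orP; left; lra.
  by rewrite distrC ltr_normr; apply/orP; left; lra.
(* Outside, [below H k x] and both cutoffs fail, so the left side is nonpositive and the right side
   is zero. *)
have [small|/allPn[h0 h0H big]] := boolP (below H (k + 6 * C) x); last first.
  rewrite -ltNge in big.
  have -> : below H k x = false by apply/negP => /allP/(_ h0 h0H) ?; lra.
  rewrite big_seq big1.
    by rewrite mulr0 sub0r; do 2 case: (below _ _ _) => /=; lra.
  move=> h hH; rewrite /facet_term.
  have -> : below H (k + 3 * C) x = false by apply/negP => /allP/(_ h0 h0H) ?; lra.
  have -> : below H (k + 3 * C) (x - w h) = false.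
    by apply/negP => /allP/(_ h0 h0H) ?; have /andP[? ?] := sgn x h0 h h0H hH; lra.
  by rewrite !mulr0 subrr.
have smallP h : h \in H -> dot h x <= k + 6 * C by move/(allP small).
(* Deep inside, all three indicators are one and 2 - 1 - 1 = 0, while every coboundary vanishes. *)
have [/hasP[h hH near]|far] := boolP (has (fun h => `|dot h x - k| <= 6 * C) H); last first.
  have hx h : h \in H -> dot h x < k - 6 * C.
    move=> hH; have := hasPn far h hH; have := smallP h hH.
    by rewrite ler_norml negb_and -!ltNge => ? /orP[]; lra.
  rewrite big_seq big1 => [|h hH]; last by rewrite term0 ?hx.
  have b y t : (forall h, h \in H -> dot h y <= t) -> below H t y by move=> ?; apply/allP.
  rewrite !b //=; first by lra.
  - move=> h hH; have ? := hx h hH; have [_ /andP[? ?]] := gsgn x h hH.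
    have /andP[? ?] := gw _ hH; lra.
  - by move=> h hH; have ? := hx h hH; have [/andP[? ?] _] := gsgn x h hH; lra.
  - by move=> h hH; have ? := hx h hH; lra.
have others h' : h' \in H -> h' != h -> dot h' x < k - 6 * C.
  move=> h'H h'h; have := hasPn nonear h hH => /hasPn/(_ h' h'H).
  rewrite /near_two small near eq_sym h'h /= ler_norml negb_and -!ltNge.
  by have := smallP h' h'H => ? /orP[]; lra.
have l0 : 0 <= l by have /andP[? ?] := gw _ hH; lra.
have -> : \sum_(i <- H) (facet_term i x - facet_term i (x - w i)) =
    facet_term h x - facet_term h (x - w h).
  rewrite (bigD1_seq h) //= big_seq_cond big1 ?addr0 // => h' /andP[h'H h'h].
  by rewrite term0 ?others.
set s := dot h x.
have -> : facet_term h x - facet_term h (x - w h) =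
    facet_profile h s - facet_profile h (s - dot h (w h)).
  rewrite /facet_term dotBr -/s; have := wC _ _ hH hH; rewrite ler_norml => /andP[w1 w2].
  (* Within 2C of [k] both cutoffs are one; beyond it both arguments are farther than [C] from [k]
     and the profiles vanish. *)
  have [s1|s1] := leP `|s - k| (2 * C).
    move: s1; rewrite ler_norml => /andP[s1 s2].
    rewrite !(@below_single h) // ?dotBr -?/s; last 2 first.
    - by move=> h' h'H h'h; have ? := others _ h'H h'h; have /andP[? ?] := sgn x h' h h'H hH; lra.
    - by move=> h' h'H h'h; have ? := others _ h'H h'h; lra.
    have -> : s - dot h (w h) <= k + 3 * C by lra.
    have -> : s <= k + 3 * C by lra.
    by rewrite !mulr1.
  rewrite !profile0 ?mul0r //; last by lra.
  by move: s1; rewrite !ltr_normr => /orP[] ?; apply/orP; [left|right]; lra.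
rewrite !(@below_single h) // ?dotBr ?dotDr -/s; last 3 first.
- by move=> h' h'H h'h; have ? := others _ h'H h'h; have [_ /andP[? ?]] := gsgn x h' h'H; lra.
- by move=> h' h'H h'h; have ? := others _ h'H h'h; have [/andP[? ?] _] := gsgn x h' h'H; lra.
- by move=> h' h'H h'h; have ? := others _ h'H h'h; lra.
have /andP[gw1 gw2] := gw _ hH; rewrite /facet_profile.
have -> : (s - dot h g <= k) = (s <= k + dot h g) by rewrite lerBlDr.
have -> : (s + dot h g <= k + l) = (s - dot h (w h) <= k + l - dot h g - dot h (w h)).
  by apply/idP/idP => ?; lra.
(* With e = [dot h g] and o = [dot h (w h)], what remains is 2 [s <= k] <= [s <= k + l - e - o] +
   [s <= k + e + o]. As 0 <= e + o <= l, both conditions on the right follow from s <= k. *)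
have [sk|_] := leP s k.
  have -> : s <= k + l - dot h g - dot h (w h) by lra.
  have -> : s - dot h (w h) <= k + dot h g by lra.
  by case: (s <= _); case: (s - _ <= _) => /=; lra.
case: (s - _ <= k + dot h g); case: (s <= k + l - _ - _).
all: by case: (s <= _); case: (s - _ <= _) => /=; lra.
Qed.

End SecondDifference.

(* A one-sided [F k <= O(k^(n-2))], in a form that also makes sense for [n = 1]. *)
Definition lower_order (R : realType) (n : nat) (F : nat -> R) : Prop :=
  exists K (k0 : nat), forall k : nat, (k0 <= k)%N ->
    k%:R * F k <= K * k%:R ^+ n.-1.

Section LowerOrder.
Variables (R : realType) (n : nat).
Implicit Types F G : nat -> R.

Lemma lower_order_le F G k1 : (forall k : nat, (k1 <= k)%N -> F k <= G k) ->
  lower_order n G -> lower_order n F.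
Proof.
move=> FG [K [k0 GK]]; exists K, (maxn k0 k1) => k; rewrite geq_max => /andP[kk0 kk1].
by apply: le_trans (GK k kk0); rewrite ler_wpM2l ?FG.
Qed.

Lemma lower_orderD F G : lower_order n F -> lower_order n G ->
  lower_order n (fun k => F k + G k).
Proof.
move=> [K [k0 FK]] [K' [k1 GK]]; exists (K + K'), (maxn k0 k1) => k.
by rewrite geq_max => /andP[kk0 kk1]; rewrite mulrDr mulrDl lerD ?FK ?GK.
Qed.

Lemma lower_orderZ a F : 0 <= a -> lower_order n F ->
  lower_order n (fun k => a * F k).
Proof.
move=> a0 [K [k0 FK]]; exists (a * K), k0 => k kk0.
by rewrite mulrCA -mulrA ler_wpM2l ?FK.
Qed.

Lemma lower_order_sum (I : eqType) (s : seq I) (F : I -> nat -> R) :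
  (forall i, i \in s -> lower_order n (F i)) ->
  lower_order n (fun k => \sum_(i <- s) F i k).
Proof.
elim: s => [|i s IH] sF.
  by exists 0, 0%N => k _; rewrite big_nil mulr0 mul0r.
have Fi : lower_order n (F i) by apply: sF; rewrite mem_head.
have Fs : lower_order n (fun k => \sum_(i <- s) F i k).
  by apply: IH => j js; apply: sF; rewrite inE js orbT.
by apply: (lower_order_le (k1 := 0%N)) (lower_orderD Fi Fs) => k _; rewrite big_cons.
Qed.

End LowerOrder.

(** * Lattice sums and residue classes *)

Lemma below_le (R : realType) (n : nat) (H : seq 'rV[R]_n) (t t' : R)
  (x : 'rV[R]_n) : t <= t' -> below H t x -> below H t' x.
Proof. by move=> tt'; apply: sub_all => h /le_trans; apply. Qed.

Lemma belowZ (R : realType) (n : nat) (H : seq 'rV[R]_n) (a t : R)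
  (x : 'rV[R]_n) : 0 < a -> below H (a * t) (a *: x) = below H t x.
Proof.
by move=> a0; apply: eq_in_all => h _; rewrite dotZr ler_pM2l.
Qed.

Definition halfspaces_bounded (R : realType) (n : nat) (H : seq 'rV[R]_n)
    (B : R) : Prop :=
  forall t x, 0 < t -> below H t x -> forall j, `|x ord0 j| <= B * t.

Definition lattice_count (R : realType) (n : nat) (H : seq 'rV[R]_n) (t : R) :
  R := \sum_(z \in [set: 'rV[int]_n]) ((below H t (realv R z))%:R : R).

Section LatticeSums.
Variables (R : realType) (n : nat).

Lemma finite_int_box (N : nat) :
  finite_set [set z : 'rV[int]_n | forall j, `|z ord0 j| <= N%:Z].
Proof.
have [] // := @fset_set_card_le_prod _ n
  [set z : 'rV[int]_n | forall j, `|z ord0 j| <= N%:Z] (fun=> (2 * N + 1)%N)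
  (fun z j => `|(z ord0 j + N%:Z)%R|%N).
  by move=> z zN j; apply: absz_shift_lt.
move=> y z yN zN yz; apply/rowP => j.
exact: absz_shift_inj (yN j) (zN j) (yz j).
Qed.

Lemma finite_below (H : seq 'rV[R]_n) (B t : R) (y : 'rV[R]_n) :
  halfspaces_bounded H B ->
  finite_set [set z : 'rV[int]_n | below H t (realv R z + y)].
Proof.
(* The coordinate bound is available at positive levels, hence [|t| + 1] in place of [t]. *)
move=> HB; pose T := B * (`|t| + 1) + \sum_j `|y ord0 j|.
apply: sub_finite_set (finite_int_box (Num.bound T)) => z /= zt j.
have t0 : 0 < `|t| + 1 by rewrite ltr_wpDl.
have t1 : t <= `|t| + 1 by rewrite (le_trans (ler_norm t)) // lerDl.
have := HB _ _ t0 (below_le t1 zt) j; rewrite !mxE => zy.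
have yj : `|y ord0 j| <= \sum_j `|y ord0 j| by rewrite (bigD1 j) //= lerDl sumr_ge0.
have zT : `|(z ord0 j)%:~R| <= T :> R.
  rewrite -[X in `|X|](addrK (y ord0 j)).
  by apply: le_trans (ler_normB _ _) _; rewrite lerD.
have T0 : 0 <= T by rewrite (le_trans _ zT).
rewrite -(ler_int R) intr_norm (le_trans zT) //.
by rewrite ltW // archi_boundP.
Qed.

Lemma fin_supp_below (H : seq 'rV[R]_n) (B t : R) (y : 'rV[R]_n) :
  halfspaces_bounded H B ->
  fin_supp (fun z : 'rV[int]_n => ((below H t (realv R z + y))%:R : R)).
Proof. by move=> HB; apply: fin_supp_indic; exact: finite_below HB. Qed.

Lemma fin_supp_le (T : choiceType) (F G : T -> R) :
  (forall x, G x = 0 -> F x = 0) -> fin_supp G -> fin_supp F.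
Proof.
by move=> GF; apply: sub_finite_set => x /=; apply: contra_neq => /GF.
Qed.

Lemma fin_supp_below0 (H : seq 'rV[R]_n) (B t : R) :
  halfspaces_bounded H B ->
  fin_supp (fun z : 'rV[int]_n => ((below H t (realv R z))%:R : R)).
Proof.
by move=> HB; apply: fin_supp_le (fin_supp_below t 0 HB) => z; rewrite addr0.
Qed.

Lemma fsum_shift (F : 'rV[int]_n -> R) (w : 'rV[int]_n) :
  \sum_(z \in [set: 'rV[int]_n]) F (z - w) = \sum_(z \in [set: 'rV[int]_n]) F z.
Proof.
rewrite [RHS](reindex_fsbigT (fun z => z - w)) //.
by exists (fun z => z + w) => z; rewrite ?subrK ?addrK.
Qed.

Lemma fsum_opp (F : 'rV[int]_n -> R) :
  \sum_(z \in [set: 'rV[int]_n]) F (- z) = \sum_(z \in [set: 'rV[int]_n]) F z.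
Proof.
rewrite [RHS](reindex_fsbigT (fun z => - z)) //.
by exists (fun z => - z) => z; rewrite opprK.
Qed.

Definition residue_row (m : nat) (c : {ffun 'I_n -> 'I_m}) : 'rV[int]_n :=
  \row_j (c j)%:Z.

(** Coordinatewise Euclidean division by [m.+1]: each integer row lies in exactly one residue
    class. *)
Lemma fsum_residues (m : nat) (F : 'rV[int]_n -> R) : fin_supp F ->
  \sum_(c : {ffun 'I_n -> 'I_m.+1}) \sum_(z \in [set: 'rV[int]_n])
    F (m.+1%:Z *: z + residue_row c) = \sum_(z \in [set: 'rV[int]_n]) F z.
Proof.
move=> fF; pose im (c : {ffun 'I_n -> 'I_m.+1}) : set 'rV[int]_n :=
  [set m.+1%:Z *: z + residue_row c | z in [set: 'rV[int]_n]].
pose G (c : {ffun 'I_n -> 'I_m.+1}) (y : 'rV[int]_n) : R := if y \in im c then F y else 0.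
transitivity (\sum_(c : {ffun 'I_n -> 'I_m.+1}) \sum_(y \in [set: 'rV[int]_n]) G c y).
  apply: eq_bigr => c _; rewrite -(fsbig_image _ (fun z => m.+1%:Z *: z + residue_row c)).
    by rewrite fsbig_mkcond.
  move=> x y _ _ /addIr/rowP xy; apply/rowP => j.
  by have := xy j; rewrite !mxE => /mulfI; apply.
rewrite -exchange_fsum => [|c]; last first.
  by apply: fin_supp_le fF => y Fy; rewrite /G; case: ifP.
apply: eq_fsbigr => y _.
pose c0 : {ffun 'I_n -> 'I_m.+1} := [ffun j => inord `|(y ord0 j %% m.+1%:Z)%Z|%N].
have modm j : (y ord0 j %% m.+1%:Z)%Z = (c0 j)%:Z.
  rewrite ffunE inordK; last by rewrite -ltz_nat gez0_abs ?modz_ge0 ?ltz_pmod.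
  by rewrite gez0_abs // modz_ge0.
rewrite (bigD1 c0) //= big1 => [|c cc0].
  rewrite addr0 /G ifT //; apply/mem_set; exists (\row_j (y ord0 j %/ m.+1%:Z)%Z) => //.
  by apply/rowP => j; rewrite !mxE -modm mulrC -divz_eq.
rewrite /G ifF //; apply: contra_neqF cc0; rewrite inE => -[z _ zy].
apply/ffunP => j; apply/val_inj/eqP; rewrite -eqz_nat -modm -zy !mxE mulrC modzMDl.
by rewrite modz_small // ltz_nat ltn_ord.
Qed.

End LatticeSums.

(** * Asymptotics of summed second differences *)

Section LatticeAsymptotics.
Variables (R : realType) (n : nat) (H : seq 'rV[R]_n) (B : R).

Lemma lower_order_near_two (C : R) (h h' : 'rV[R]_n) :
  h \in H -> 0 \notin H -> 0 <= B -> halfspaces_bounded H B -> 0 <= C ->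
  lower_order n (fun k => \sum_(z \in [set: 'rV[int]_n])
    ((near_two H k%:R C h h' (realv R z))%:R : R)).
Proof.
move=> hH H0 B0 HB C0; have [<-|hh'] := eqVneq h h'.
  exists 0, 0%N => k _; rewrite fsbig1 ?mulr0 ?mul0r // => z _.
  by rewrite /near_two eqxx.
have h0 : h != 0 by apply: contraNneq H0 => <-.
(* For k >= 1 the level k + 6C is at most (1 + 6C) k, which gives a coordinate bound linear in
   [k]. *)
pose b := Num.bound (B * (1 + 6 * C)).
have [|K [k0 Kk0]] := @near_two_hyperplanes R n h h' b (6 * C) hh' h0; first by lra.
exists K%:R, (maxn k0 1) => k; rewrite geq_max => /andP[/Kk0 + k_gt0].
set A := mkset _ => -[fA cA].
have subA : [set z : 'rV[int]_n | near_two H k%:R C h h' (realv R z)] `<=` A.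
  move=> z /= /and4P[_ zb zh zh']; split => // j.
  have k1 : 1 <= k%:R :> R by rewrite ler1n.
  have kC : 0 < k%:R + 6 * C by lra.
  rewrite -(ler_int R) intr_norm -[(b * k)%:Z%:~R]/((b * k)%:R) natrM.
  have := HB _ _ kC zb j; rewrite mxE => /le_trans; apply.
  apply: le_trans (_ : B * (1 + 6 * C) * k%:R <= _).
    by rewrite -mulrA ler_wpM2l //; nra.
  rewrite ler_wpM2r // ltW // archi_boundP // mulr_ge0 //; lra.
have fnear := sub_finite_set subA fA.
rewrite fsum_indic // -natrX -!natrM ler_nat (leq_trans _ cA) // leq_mul2l.
rewrite (fsubset_leq_card _) ?orbT //.
by apply/fsubsetP => z; rewrite !in_fset_set // !inE; exact: subA.
Qed.

Lemma lower_order_second_difference (l : R) (g : 'rV[R]_n) :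
  uniq H -> 0 \notin H -> 0 <= B -> halfspaces_bounded H B ->
  (forall h, h \in H -> exists z : 'rV[int]_n, 0 < dot h (realv R z) <= l) ->
  0 <= l ->
  lower_order n (fun k => 2 * lattice_count H k%:R -
    \sum_(z \in [set: 'rV[int]_n]) ((below H k%:R (realv R z - g))%:R : R) -
    \sum_(z \in [set: 'rV[int]_n]) ((below H (k%:R + l) (realv R z + g))%:R : R)).
Proof.
move=> uH H0 B0 HB Hz l0.
have /choice[zz zzP] : forall h, exists z : 'rV[int]_n,
    h \in H -> 0 < dot h (realv R z) <= l.
  move=> h; have [/Hz[z zP]|hH] := boolP (h \in H); first by exists z.
  by exists 0.
(* Division with remainder by the positive number [dot h (realv R (zz h))], which is at most [l],
   brings h (g + w) into [0, l]. *)
pose w h := - (Num.floor (dot h g / dot h (realv R (zz h))) *: zz h).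
have realvE (a : int) (z : 'rV[int]_n) : realv R (- (a *: z)) = - (a%:~R *: realv R z).
  by apply/rowP => j; rewrite !mxE rmorphN rmorphM.
have gw h : h \in H -> 0 <= dot h g + dot h (realv R (w h)) <= l.
  move=> /zzP/andP[z0 zl]; rewrite realvE dotNr dotZr.
  have /andP := floor_itv (dot h g / dot h (realv R (zz h))).
  rewrite ler_pdivlMr // ltr_pdivrMr // intrD mulrDl => -[? ?].
  by apply/andP; split; lra.
(* One constant dominating [l] and all displacements, independent of [k]. *)
pose C := l + \sum_(h <- H) `|dot h g| +
  \sum_(h <- H) \sum_(h' <- H) `|dot h (realv R (w h'))|.
have S1 : 0 <= \sum_(h <- H) `|dot h g| by exact: sumr_ge0.
have S2 : 0 <= \sum_(h <- H) \sum_(h' <- H) `|dot h (realv R (w h'))|.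
  by apply: sumr_ge0 => *; exact: sumr_ge0.
have lC : l <= C by rewrite /C; lra.
have gC h : h \in H -> `|dot h g| <= C.
  move=> hH; apply: le_trans (_ : \sum_(h <- H) `|dot h g| <= _); last by rewrite /C; lra.
  by rewrite (bigD1_seq h) //= lerDl sumr_ge0.
have wC h h' : h \in H -> h' \in H -> `|dot h (realv R (w h'))| <= C.
  move=> hH h'H; apply: le_trans
    (_ : \sum_(h <- H) \sum_(h' <- H) `|dot h (realv R (w h'))| <= _);
    last by rewrite /C; lra.
  rewrite (bigD1_seq h) //= (bigD1_seq h') //= -addrA lerDl addr_ge0 ?sumr_ge0 //.
  by move=> *; exact: sumr_ge0.
have C0 : 0 <= C by lra.
pose near k z : R :=
  \sum_(h <- H) \sum_(h' <- H) (near_two H k%:R C h h' (realv R z))%:R.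
have fbelow t y : fin_supp (fun z : 'rV[int]_n => ((below H t (realv R z + y))%:R : R)).
  exact: fin_supp_below HB.
have fbelow0 t : fin_supp (fun z : 'rV[int]_n => ((below H t (realv R z))%:R : R)).
  exact: fin_supp_below0 HB.
have fnear2 k h h' : fin_supp (fun z => ((near_two H k%:R C h h' (realv R z))%:R : R)).
  apply: fin_supp_le (fbelow0 (k%:R + 6 * C)) => z; rewrite /near_two.
  by case: (below _ _ _); [move/eqP; rewrite oner_eq0 | rewrite andbF].
have fnear k : fin_supp (near k).
  by apply: fin_supp_sum => h; exact: fin_supp_sum.
have near_lower : lower_order n (fun k =>
    (2 + 2 * (size H)%:R) * \sum_(z \in [set: 'rV[int]_n]) near k z).
  apply: lower_orderZ; first by rewrite addr_ge0 ?mulr_ge0.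
  apply: (lower_order_le (k1 := 0%N)
    (G := fun k => \sum_(h <- H) \sum_(h' <- H) \sum_(z \in [set: 'rV[int]_n])
       ((near_two H k%:R C h h' (realv R z))%:R : R))).
    move=> k _; rewrite exchange_fsum => [|h]; last exact: fin_supp_sum.
    by apply: ler_sum => h _; rewrite exchange_fsum.
  apply: lower_order_sum => h hH; apply: lower_order_sum => h' _.
  exact: lower_order_near_two.
apply: (lower_order_le (k1 := 0%N)) near_lower => k _.
pose psi h (z : 'rV[int]_n) := facet_term H l k%:R C g (fun h => realv R (w h)) h (realv R z).
have fpsi h : fin_supp (psi h).
  apply: fin_supp_le (fbelow0 (k%:R + 3 * C)) => z; rewrite /psi /facet_term => ->.
  by rewrite mulr0.
have fpsiw h : fin_supp (fun z => psi h (z - w h)).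
  by apply: fin_supp_inj (fpsi h) => y z /addIr.
pose b1 (z : 'rV[int]_n) : R := (below H k%:R (realv R z))%:R.
pose b2 (z : 'rV[int]_n) : R := (below H k%:R (realv R z - g))%:R.
pose b3 (z : 'rV[int]_n) : R := (below H (k%:R + l) (realv R z + g))%:R.
have fb1 : fin_supp (fun z => 2 * b1 z) by exact: fin_suppZ (fbelow0 _).
have fb2 : fin_supp b2 by exact: fbelow.
have fb3 : fin_supp b3 by exact: fbelow.
have fb12 := fin_suppB fb1 fb2.
have fpsis : fin_supp (fun z => \sum_(h <- H) (psi h z - psi h (z - w h))).
  by apply: fin_supp_sum => h; exact: fin_suppB.
have fK : fin_supp (fun z => (2 + 2 * (size H)%:R) * near k z) by exact: fin_suppZ (fnear k).
apply: le_trans (_ : \sum_(z \in [set: 'rV[int]_n]) (2 * b1 z - b2 z - b3 z) <= _).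
  by rewrite (fsumB fb12 fb3) (fsumB fb1 fb2) -mulr_fsumr.
apply: le_trans (ler_fsum (fin_suppB fb12 fb3) (fin_suppD fpsis fK) _) _ => [z|].
  have := @second_difference_le R n H l k%:R C g (fun h => realv R (w h))
    (realv R z) uH C0 lC gC wC gw.
  move=> /le_trans; apply; rewrite lerD2r; apply: ler_sum => h _.
  by rewrite /psi (_ : realv R (z - w h) = realv R z - realv R (w h)) // [LHS]map_mxB.
rewrite (fsumD fpsis fK) -mulr_fsumr exchange_fsum => [|h]; last exact: fin_suppB.
(* The coboundaries sum to zero because [w h] is a lattice vector and the sum is translation
   invariant. *)
rewrite big1 ?add0r // => h _.
by rewrite (fsumB (fpsi h) (fpsiw h)) fsum_shift subrr.
Qed.

End LatticeAsymptotics.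

(** Sum the previous bound over g = c / m.+1 for all residues c. After scaling by [m.+1], the points
    m.+1 z - c, and likewise m.+1 z + c, run once through all of Z^n. *)
Lemma lower_order_residues (R : realType) (n : nat) (H : seq 'rV[R]_n)
    (B l : R) (m : nat) :
  uniq H -> 0 \notin H -> 0 <= B -> halfspaces_bounded H B ->
  (forall h, h \in H -> exists z : 'rV[int]_n, 0 < dot h (realv R z) <= l) ->
  0 <= l ->
  lower_order n (fun k => 2 * m.+1%:R ^+ n * lattice_count H k%:R -
    lattice_count H (m.+1%:R * k%:R) - lattice_count H (m.+1%:R * (k%:R + l))).
Proof.
move=> uH H0 B0 HB Hz l0.
have m0 : 0 < m.+1%:R :> R by rewrite ltr0Sn.
pose g (c : {ffun 'I_n -> 'I_m.+1}) : 'rV[R]_n := m.+1%:R^-1 *: realv R (residue_row c).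
have lo := lower_order_sum (s := index_enum {ffun 'I_n -> 'I_m.+1})
  (fun c _ => lower_order_second_difference (g c) uH H0 B0 HB Hz l0).
apply: (lower_order_le (k1 := 0%N)) lo => k _.
rewrite !sumrB sumr_const card_ffun !card_ord lerB //; last first.
  rewrite /lattice_count -(@fsum_residues R n m); last exact: fin_supp_below0 HB.
  apply: ler_sum => c _; rewrite le_eqVlt; apply/orP; left; apply/eqP.
  apply: eq_fsbigr => z _; rewrite -[in LHS](@belowZ R n H m.+1%:R) //.
  congr (below H _ _)%:R; rewrite scalerDr scalerA mulfV ?gt_eqF // scale1r.
  by apply/rowP => j; rewrite !mxE intrD intrM.
rewrite lerB //; first by rewrite -[leRHS]mulr_natr natrX; lra.
(* The residue enters with a minus sign here: the whole lattice is negated first, then [z] within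
   each class. *)
rewrite /lattice_count -fsum_opp -(@fsum_residues R n m); last first.
  apply: (@fin_supp_inj _ R _ (fun z => (below H (m.+1%:R * k%:R) (realv R z))%:R));
    first exact: oppr_inj.
  exact: fin_supp_below0 HB.
apply: ler_sum => c _; rewrite -fsum_opp le_eqVlt; apply/orP; left; apply/eqP.
apply: eq_fsbigr => z _; rewrite -[in LHS](@belowZ R n H m.+1%:R) //.
congr (below H _ _)%:R; rewrite scalerBr scalerA mulfV ?gt_eqF // scale1r.
by apply/rowP => j; rewrite !mxE !(rmorphN, rmorphD, rmorphM) /=; ring.
Qed.

(** * Comparison of coefficients *)

Lemma coef_affine_exp (R : comNzRingType) (a b : R) (i j : nat) :
  ((a *: 'X + b%:P) ^+ i)`_j = a ^+ j * b ^+ (i - j) *+ 'C(i, j).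
Proof.
have term (k : nat) : (b%:P ^+ (i - k) * (a *: 'X) ^+ k *+ 'C(i, k))`_j =
    if k == j then a ^+ j * b ^+ (i - j) *+ 'C(i, j) else 0.
  rewrite coefMn exprZn -polyC_exp mul_polyC coefZ coefZ coefXn eq_sym.
  by case: eqP => [->|_]; rewrite ?mulr1 ?mulr0 ?mul0rn // mulrC.
rewrite addrC exprDn coef_sum; under eq_bigr do rewrite term.
have [ji|ij] := ltnP j i.+1.
  by rewrite (bigD1 (Ordinal ji)) //= eqxx big1 ?addr0 // => k; rewrite -val_eqE => /negPf ->.
rewrite bin_small // mulr0n big1 // => k _.
by rewrite ifF // ltn_eqF // (leq_trans (ltn_ord k)).
Qed.

Lemma coef_comp_affine (R : comNzRingType) (p : {poly R}) (a b : R) (d : nat) :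
  size p = d.+2 ->
  (p \Po (a *: 'X + b%:P))`_d.+1 = a ^+ d.+1 * p`_d.+1 /\
  (p \Po (a *: 'X + b%:P))`_d = a ^+ d * (p`_d + b * p`_d.+1 *+ d.+1).
Proof.
move=> sp; have E j : (p \Po (a *: 'X + b%:P))`_j =
    \sum_(i < d.+2) p`_i * (a ^+ j * b ^+ (i - j) *+ 'C(i, j)).
  by rewrite comp_polyE sp coef_sum; under eq_bigr do rewrite coefZ coef_affine_exp.
rewrite !E !big_ord_recr !big1 /= => [|i _|i _]; last 2 first.
- by rewrite bin_small ?mulr0n ?mulr0.
- by rewrite bin_small ?mulr0n ?mulr0 // ltnS ltnW.
rewrite !add0r !subnn !binn subSnn bin_small // binSn !expr0 expr1 !mulr1n mulr0n.
split; first by rewrite mulr0 add0r mulr1 mulrC.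
rewrite mulr1 mulrDr (mulrC p`_d) !mulrnAr; congr (_ + _ *+ _).
by rewrite mulrCA (mulrC p`_d.+1).
Qed.

(** The hypothesis reads k p(k) <= K k^d, while k p(k) >= p_d k^(d+1) - S k^d with [S] bounding the
    lower coefficients. A positive p_d contradicts this for large [k]. *)
Lemma lower_order_poly (R : realType) (d : nat) (p : {poly R}) :
  (size p <= d.+1)%N -> lower_order d.+1 (fun k => p.[k%:R]) -> p`_d <= 0.
Proof.
move=> sp [K [k0 pK]]; rewrite leNgt; apply/negP => pd.
pose S := \sum_(i < d) `|p`_i|.
have S0 : 0 <= S by exact: sumr_ge0.
have up (k : nat) : (k0 <= k)%N -> (0 < k)%N -> p`_d * k%:R <= K + S.
  move=> kk0 k1; have k1' : 1 <= k%:R :> R by rewrite ler1n.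
  have kd : 0 < k%:R ^+ d :> R by rewrite exprn_gt0 // ltr0n.
  rewrite -(ler_pM2r kd) mulrDl -lerBlDr.
  apply: le_trans (pK k kk0); rewrite (horner_coef_wide _ sp) big_ord_recr /= mulrDr.
  rewrite addrC lerD //; last by rewrite le_eqVlt mulrCA mulrA eqxx.
  rewrite -mulNr -sumrN mulr_suml mulr_sumr; apply: ler_sum => i _.
  rewrite mulrCA -exprS; have := ler_norm (- p`_i); rewrite normrN => pi.
  have le1 : k%:R ^+ i.+1 <= k%:R ^+ d :> R by rewrite ler_weXn2l // ltn_ord.
  have le0 : 0 <= k%:R ^+ i.+1 :> R by rewrite exprn_ge0.
  by have := normr_ge0 p`_i; nra.
pose k := maxn (maxn k0 1) (Num.bound ((`|K| + S + 1) / p`_d)).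
have := up k; rewrite leNgt => /(_ _ _)/wrap[||].
- by rewrite /k !leq_max leqnn.
- by rewrite /k !leq_max orbT.
move/negP; apply; rewrite mulrC -ltr_pdivrMr //.
apply: lt_le_trans (_ : (Num.bound ((`|K| + S + 1) / p`_d))%:R <= _).
  apply: le_lt_trans (archi_boundP _); last by rewrite divr_ge0 ?(ltW pd) // !addr_ge0.
  by rewrite ler_pM2r ?invr_gt0 //; have := ler_norm K; lra.
by rewrite ler_nat /k leq_max leqnn orbT.
Qed.

Lemma coef_comp_affine_eq0 (R : comNzRingType) (p : {poly R}) (a b : R) (j : nat) :
  (size p <= j)%N -> (p \Po (a *: 'X + b%:P))`_j = 0.
Proof.
move=> pj; rewrite comp_polyE coef_sum big1 // => i _.
by rewrite coefZ coef_affine_exp bin_small ?mulr0n ?mulr0 // (leq_trans (ltn_ord i)).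
Qed.

(** The leading terms cancel, so the coefficient of degree [d] is nonpositive; division by m.+1 ^ d
    gives [main]. The integer [L] rounds m.+1 l up so that [p] is evaluated only at integers. *)
Lemma subleading_coef_le (R : realType) (d : nat) (p : {poly R}) (l : R) :
  size p = d.+2 -> 0 <= l ->
  (forall m L : nat, m.+1%:R * l <= L%:R ->
     lower_order d.+1 (fun k => 2 * m.+1%:R ^+ d.+1 * p.[k%:R] -
       p.[m.+1%:R * k%:R] - p.[m.+1%:R * k%:R + L%:R])) ->
  2 * p`_d <= d.+1%:R * l * p`_d.+1.
Proof.
move=> sp l0 low; have main m L : m.+1%:R * l <= L%:R ->
    2 * m%:R * p`_d <= d.+1%:R * L%:R * p`_d.+1.
  move=> mL; pose a : R := m.+1%:R.
  pose q := (2 * a ^+ d.+1) *: p - (p \Po (a *: 'X + 0%:P)) -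
    (p \Po (a *: 'X + L%:R%:P)).
  have [t1 s1] := coef_comp_affine a 0 sp; have [t2 s2] := coef_comp_affine a L%:R sp.
  have sq : (size q <= d.+1)%N.
    apply/leq_sizeP => j; rewrite leq_eqVlt => /predU1P[<-|dj]; rewrite /q !coefB coefZ.
      by rewrite t1 t2; ring.
    by rewrite !coef_comp_affine_eq0 ?sp // nth_default ?sp // mulr0 !subr0.
  have qd : q`_d = 2 * a ^+ d.+1 * p`_d - a ^+ d * (p`_d + 0 * p`_d.+1 *+ d.+1) -
      a ^+ d * (p`_d + L%:R * p`_d.+1 *+ d.+1) by rewrite /q !coefB coefZ s1 s2.
  have : q`_d <= 0.
    apply: lower_order_poly sq _; apply: (lower_order_le (k1 := 0%N)) (low m L mL) => k _.
    by rewrite !hornerE !horner_comp !hornerE.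
  have ad : 0 < a ^+ d by rewrite exprn_gt0 // ltr0Sn.
  rewrite qd mul0r mul0rn addr0 exprS -mulr_natl => le0.
  rewrite -subr_le0 -(pmulr_rle0 _ ad); apply: le_trans le0; rewrite le_eqVlt; apply/orP; left.
  have -> : m%:R = a - 1 by rewrite /a -natr1 addrK.
  by apply/eqP; ring.
rewrite leNgt; apply/negP => gt.
(* Rounding gives L <= m l + l + 1, so [main] yields m e <= D for every [m]; the choice of [m] below
   violates this. *)
pose e := 2 * p`_d - d.+1%:R * l * p`_d.+1; have e0 : 0 < e by rewrite subr_gt0.
pose D := d.+1%:R * `|p`_d.+1| * (l + 1).
have D0 : 0 <= D by rewrite !mulr_ge0 // addr_ge0.
pose m := Num.bound (D / e).
have mD : D < m%:R * e by rewrite -ltr_pdivrMr // archi_boundP // divr_ge0 // ltW.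
have ml0 : 0 <= m.+1%:R * l by rewrite mulr_ge0.
have := main m `|Num.ceil (m.+1%:R * l)|%N.
have cE : (`|Num.ceil (m.+1%:R * l)|%N)%:R = (Num.ceil (m.+1%:R * l))%:~R :> R.
  by rewrite -[LHS]/((Posz _)%:~R) gez0_abs // -(ler_int R) (le_trans ml0) // ceil_ge.
rewrite cE ceil_ge => /(_ isT).
set c : R := (Num.ceil _)%:~R => le1.
have yE : m.+1%:R * l = m%:R * l + l by rewrite mulrSr mulrDl mul1r.
have c1 : m%:R * l + l <= c by rewrite -yE ceil_ge.
have c2 : c < m%:R * l + l + 1.
  by have /andP[+ _] := ceil_itv (m.+1%:R * l); rewrite intrB ltrBlDr -yE.
have c3 : (c - m%:R * l) * p`_d.+1 <= (l + 1) * `|p`_d.+1|.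
  apply: le_trans (ler_norm _) _; rewrite normrM; apply: ler_wpM2r => //; rewrite ger0_norm; lra.
have : d.+1%:R * ((c - m%:R * l) * p`_d.+1) <= D.
  rewrite /D -[leRHS]mulrA; apply: ler_wpM2l => //.
  by rewrite [leRHS]mulrC.
by move: mD le1; rewrite /e; lra.
Qed.

(** * Dilates, successive minima and the final estimate *)

Lemma realv_inj (R : realType) (n : nat) : injective (@realv R n).
Proof.
move=> x y /rowP xy; apply/rowP => j.
by have := xy j; rewrite !mxE => /intr_inj.
Qed.

Lemma lattice_count_dilate (R : realType) (n : nat) (P : set 'rV[R]_n)
    (H : seq 'rV[R]_n) (B t : R) : halfspaces_bounded H B ->
  (forall x, dilate t P x <-> below H t x) ->
  (#|` fset_set (dilate t P `&` @Zlattice R n)|)%:R = lattice_count H t.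
Proof.
move=> HB PH; have fb : finite_set [set z : 'rV[int]_n | below H t (realv R z)].
  by apply: sub_finite_set (finite_below t 0 HB) => z; rewrite /= addr0.
rewrite /lattice_count fsum_indic //.
have -> : dilate t P `&` @Zlattice R n = @realv R n @` [set z | below H t (realv R z)].
  apply/seteqP; split=> [x [/PH xt xZ]|_ [z zt <-]].
    have xE : realv R (\row_j Num.floor (x ord0 j)) = x.
      by apply/rowP => j; rewrite !mxE floorK.
    by exists (\row_j Num.floor (x ord0 j)); rewrite /= xE.
  by split; [exact/PH | move=> j; rewrite mxE intr_int].
by rewrite fset_set_image // card_imfset //; exact: realv_inj.
Qed.

(** The lattice points of the dilate span the space, so [h] is nonzero at one of them; symmetry
    fixes the sign. *)
Lemma succ_min_set_dual (R : realType) (n : nat) (P : set 'rV[R]_n)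
    (h : 'rV[R]_n) (l : R) : h != 0 ->
  (forall x, dilate l P x -> dot h x <= l) ->
  (forall x, dilate l P x -> dilate l P (- x)) ->
  succ_min_set n P l -> exists z : 'rV[int]_n, 0 < dot h (realv R z) <= l.
Proof.
move=> h0 hl PN [l0 dimA].
have [x [Px xZ] hx] : exists2 x, (dilate l P `&` @Zlattice R n) x & dot h x != 0.
  apply: contra_neqP h0 => /forall2NP A0; apply: (dot_eq0_lin_span dimA) => x Ax.
  by case: (A0 x) => // /negP/negPn/eqP.
have [y [Py yZ] hy] : exists2 y, (dilate l P `&` @Zlattice R n) y & 0 < dot h y.
  have [hx0|hx0|/eqP] := ltrgtP (dot h x) 0; last by rewrite (negPf hx).
    exists (- x); last by rewrite dotNr oppr_gt0.
    by split; [exact: PN | move=> j; rewrite mxE rpredN].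
  by exists x.
exists (\row_j Num.floor (y ord0 j)).
suff -> : realv R (\row_j Num.floor (y ord0 j)) = y by rewrite hy hl.
by apply/rowP => j; rewrite !mxE floorK.
Qed.

(** Guards against the default value of [inf] on the empty set: the dilate by S + 1 contains all
    unit vectors. *)
Lemma succ_min_set_nonempty (R : realType) (n : nat) (P : set 'rV[R]_n)
    (H : seq 'rV[R]_n) : uniq H ->
  (forall t x, 0 < t -> dilate t P x <-> below H t x) ->
  succ_min_set n P !=set0.
Proof.
move=> uH PH; pose S := \sum_(h <- H) \sum_j `|h ord0 j|.
have S0 : 0 <= S by apply: sumr_ge0 => h _; exact: sumr_ge0.
exists (S + 1); split; first by lra.
have [VA _] := lin_spanP (dilate (S + 1) P `&` @Zlattice R n).
suff /eqP -> : lin_span (dilate (S + 1) P `&` @Zlattice R n) == fullv.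
  by rewrite dimvf /dim /= mul1n.
rewrite eqEsubv subvf /=; apply/subvP => x _; rewrite (row_sum_delta x).
apply: memv_suml => j _; apply: memvZ; apply: VA; split; last first.
  by move=> i; rewrite mxE; case: andb; rewrite ?rpred0 ?rpred1.
apply/PH; first by lra.
apply/allP => h hH; rewrite dot_delta (le_trans (ler_norm _)) //.
apply: le_trans (_ : S <= _); last by lra.
rewrite /S (bigD1_seq h) //= (bigD1 j) //= -addrA lerDl addr_ge0 ?sumr_ge0 //.
by move=> *; exact: sumr_ge0.
Qed.

(* The order of R[i] makes x <= y hold iff y - x is a nonnegative real, so the
   conclusion also says that the sum of the gamma i is real. *)
Theorem corollary1p4 (R : realType) (n : nat) (n_gt0 : (0 < n)%N)
  (P : set 'rV[R]_n) (P_lattice : lattice_polytope P) (P_dim : aff_dim P = n)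
  (P_sym : P = [set - x | x in P])
  (G : {poly R}) (G_ehrhart : ehrhart_poly P G)
  (gamma : 'I_n -> R[i])
  (G_roots : roots_with_mult (map_poly (real_complex R) G)
               [seq - gamma i | i <- enum 'I_n]) :
  n%:R^-1 * (\sum_(i < n) gamma i) <= (succ_min n P / 2)%:C.
Proof.
have [P_poly _] := P_lattice.
have [H [uH H0 PH]] := symmetric_polytope_halfspaces n_gt0 P_poly P_dim P_sym.
have [B B0 PB] := polytope_bounded P_poly.
have {}PH t x : 0 < t -> dilate t P x <-> below H t x by exact: PH.
have HB : halfspaces_bounded H B.
  by move=> t x t0 /PH-/(_ t0) Px j; apply: PB Px j; exact: ltW.
have count t : 0 < t -> (#|` fset_set (dilate t P `&` @Zlattice R n)|)%:R = lattice_count H t.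
  by move=> t0; apply: lattice_count_dilate HB _ => x; exact: PH.
have GN (k : nat) : (0 < k)%N -> G.[k%:R] = lattice_count H k%:R.
  by move=> k0; rewrite G_ehrhart // count // ltr0n.
case: n n_gt0 P P_lattice P_dim P_sym G_ehrhart gamma G_roots P_poly
  H uH H0 PH PB HB count GN => // d _ P P_lattice P_dim P_sym G_ehrhart gamma
  [G0 GE] P_poly H uH H0 PH PB HB count GN.
set s := [seq - gamma i | i <- enum 'I_d.+1] in GE.
have ss : size s = d.+1 by rewrite size_map size_enum_ord.
have lead0 : lead_coef (map_poly (real_complex R) G) != 0 by rewrite lead_coef_eq0.
have sG : size G = d.+2.
  by rewrite -(size_map_poly (real_complex R)) GE size_scale // size_prod_XsubC ss.
have leadE : lead_coef (map_poly (real_complex R) G) = (G`_d.+1)%:C.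
  by rewrite lead_coef_map lead_coefE sG.
(* Vieta: the subleading coefficient of the monic product is minus the sum of the roots
   [- gamma i]. *)
have sumE : (G`_d)%:C = (G`_d.+1)%:C * \sum_i gamma i.
  have := congr1 (fun p : {poly R[i]} => p`_d) GE; rewrite coef_map coefZ leadE => ->.
  have := @coefPn_prod_XsubC _ s; rewrite ss => -> //.
  by rewrite big_map big_enum /= sumrN opprK.
have Gd0 : G`_d.+1 != 0.
  by apply: contra_neq lead0; rewrite leadE => ->.
(* [G] counts points, so [- G] is nonpositive at positive integers and its leading coefficient
   cannot be positive. *)
have Gd : 0 < G`_d.+1.
  rewrite lt_def Gd0 /= -oppr_le0 -coefN; apply: lower_order_poly.
    by rewrite size_polyN sG.
  exists 0, 1%N => k k0; rewrite mul0r hornerN GN // mulrN oppr_le0 mulr_ge0 //.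
  by apply: fsumr_ge0.
have bound l : succ_min_set d.+1 P l -> 2 * G`_d <= d.+1%:R * l * G`_d.+1.
  move=> Sl; have l0 : 0 < l by case: Sl.
  have Hz h : h \in H -> exists z : 'rV[int]_d.+1, 0 < dot h (realv R z) <= l.
    move=> hH; apply: succ_min_set_dual Sl.
    - by apply: contraNneq H0 => <-.
    - by move=> x /(PH _ _ l0)/allP; apply.
    - move=> _ [x Px <-]; exists (- x); last by rewrite scalerN.
      by rewrite P_sym; exists x.
  apply: (subleading_coef_le sG (ltW l0)) => m L mL.
  (* [G] gives the count only for k >= 1. Enlarging the level m.+1 (k + l) to the integer m.+1 k + L
     only increases a count that enters negatively. *)
  apply: (lower_order_le (k1 := 1%N)) (lower_order_residues m uH H0 B0 HB Hz (ltW l0)) => k k0.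
  rewrite -natrM -natrD !GN ?addn_gt0 ?muln_gt0 ?k0 // lerB //.
  apply: ler_fsum => [||z]; do ?exact: fin_supp_below0 HB.
  have le : m.+1%:R * (k%:R + l) <= (m.+1 * k + L)%:R.
    by rewrite mulrDr natrD natrM lerD2l.
  have := @below_le R _ H _ _ (realv R z) le; rewrite ler_nat.
  by case: (below H _ _) => // ->.
have sumE' : \sum_i gamma i = (G`_d / G`_d.+1)%:C.
  have Gd0C : (G`_d.+1)%:C != 0 by rewrite -leadE.
  by apply: (mulfI Gd0C); rewrite -sumE -rmorphM mulrC divfK.
have -> : d.+1%:R^-1 * \sum_i gamma i = (d.+1%:R^-1 * (G`_d / G`_d.+1))%:C.
  by rewrite sumE' [RHS]rmorphM fmorphV rmorph_nat.
rewrite lecR ler_pdivlMr // mulrC.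
(* The estimate holds for each [l] in the set and so passes to the infimum. *)
apply: lb_le_inf; first exact: succ_min_set_nonempty uH PH.
move=> l /bound Gl.
have -> : 2 * (d.+1%:R^-1 * (G`_d / G`_d.+1)) = 2 * G`_d / (d.+1%:R * G`_d.+1).
  by rewrite invfM !mulrA (mulrAC 2).
by rewrite ler_pdivrMr ?mulr_gt0 ?ltr0Sn // mulrA (mulrC l).
Qed.
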